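(* Let $S\subseteq\mathbb{Z}$ be a finite set with $|S|\ge 3$ and let $s_0\in S$. The following are equivalent: (i) there is a finite AP-free colouring of $\mathbb{N}$ that contains no almost-monochromatic positive homothetic copy of $(S,s_0)$ (contained in $\mathbb{N}$); (ii) there is a finite AP-free colouring of $\mathbb{R}$ that contains no almost-monochromatic positive homothetic copy of $(S,s_0)$; (iii) $|S|>3$ and $s_0$ is not an extreme point of $S$ (i.e. $s_0\neq\min S$ and $s_0\neq\max S$).
   Context: A colouring is finite if it uses finitely many colours. An infinite arithmetic progression is a set $\{a+mt: m\in\mathbb{N}\}$ with $t\neq 0$; a colouring is AP-free if it contains no monochromatic infinite arithmetic progression. A positive homothetic copy of $(S,s_0)$ is $(c+\lambda S,c+\lambda s_0)$ with $c\in\mathbb{R}$, $\lambda>0$. A pair $(T,t_0)$ with $t_0\in T$ is almost-monochromatic if $T\setminus\{t_0\}$ is monochromatic but $T$ is not. *)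

(* Defs.v *)
From HB Require Import structures.
From mathcomp Require Import all_boot all_order all_algebra.
From mathcomp Require Import finmap.
From mathcomp Require Import boolp classical_sets functions cardinality reals.

Set Implicit Arguments.
Unset Strict Implicit.
Unset Printing Implicit Defensive.
Import Order.TTheory GRing.Theory Num.Theory.
Local Open Scope classical_set_scope.
Local Open Scope ring_scope.

(* A colouring of a part of the real line is a function [chi : D -> C], where
   the coloured points are given by a type [D] and an injection [iota : D -> R]:
   [D = nat] with the canonical cast for colourings of N, [D = R] with the
   identity for colourings of R. A progression or a homothetic copy lying in
   the coloured part is then a set [A : set D] whose image [iota @` A] is one
   in R. A colouring is finite when [C] is ['I_k] for some [k]. *)

Definition monochromatic (D C : Type) (chi : D -> C) (A : set D) : Prop :=
  exists c : C, forall x : D, A x -> chi x = c.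

Definition infinite_AP (R : realType) (A : set R) : Prop :=
  exists a t : R, t != 0 /\ A = [set a + m%:R * t | m in [set: nat]].

Definition AP_free (R : realType) (D C : Type) (iota : D -> R)
    (chi : D -> C) : Prop :=
  forall A : set D, infinite_AP (iota @` A) -> ~ monochromatic chi A.

Definition positive_homothetic_copy (R : realType) (S : set R) (s0 : R)
    (T : set R) (t0 : R) : Prop :=
  exists c l : R,
    [/\ 0 < l, T = [set c + l * s | s in S] & t0 = c + l * s0].

Definition almost_monochromatic (D C : Type) (chi : D -> C)
    (T : set D) (t0 : D) : Prop :=
  [/\ T t0, monochromatic chi (T `\ t0) & ~ monochromatic chi T].

Definition AM_copy_free (R : realType) (D C : Type) (iota : D -> R)
    (chi : D -> C) (S : {fset int}) (s0 : int) : Prop :=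
  forall (T : set D) (t0 : D),
    positive_homothetic_copy [set s%:~R | s in [set` S]] s0%:~R
      (iota @` T) (iota t0) ->
    ~ almost_monochromatic chi T t0.

Definition extreme_point (S : {fset int}) (s0 : int) : Prop :=
  s0 \in S /\
  ((forall s, s \in S -> s0 <= s) \/ (forall s, s \in S -> s <= s0)).

(* Main.v *)
(** (i) -> (iii). Being free of almost-monochromatic copies lets a colour
    propagate: once the points of a copy of S other than the image of s0 share
    a colour, so does the image of s0. If s0 = max S, a long monochromatic
    progression (van der Waerden) therefore extends to the right for ever. If
    s0 = min S, it extends to the left as far as N allows; starting arbitrarily
    far out with boundedly many possible differences, the pigeonhole principle
    yields an infinite monochromatic progression. If |S| = 3 and s0 is in the
    middle, rescaling makes every colour class closed under
    x, x + n u |-> x + p u, where n = p + q and p, q are coprime. Van der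
    Waerden applied to the multiples of N = n ^ s gives a progression of
    bounded length with bounded step m N, which the closure refines to one of
    the same extent, up to a constant factor, with bounded step m. So along a
    fixed progression one colour contains intervals [x, y] with x arbitrarily
    large and y >= (1 + 1 / D) x for a constant D. Interpolating between such
    an interval and a fixed interval of the same colour, and then filling the
    gaps, extends it to the left down to a constant.

    (iii) -> (ii). Colour x by its sign and by floor (K ln |x|) modulo M. For
    suitable K and M, three points in the prescribed ratio that have the same
    colour lie in a common block [floor (K ln |x|) = const]: two far apart
    blocks would force the two larger points to be in almost constant ratio
    different from 1, hence in different, but nearby, blocks. A block is an
    interval, and s0 lies between the other points.

    (ii) -> (i) is restriction to N. *)

Require Import Defs.
From HB Require Import structures.
From mathcomp Require Import all_boot all_order all_algebra.
From mathcomp Require Import finmap.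
From mathcomp Require Import boolp classical_sets functions cardinality reals.
From mathcomp Require Import exp.
From mathcomp Require Import zify ring lra.

Set Implicit Arguments.
Unset Strict Implicit.
Unset Printing Implicit Defensive.

(** * Van der Waerden's theorem *)

Definition vdW_bound (C : finType) (k W : nat) : Prop :=
  forall chi : nat -> C, exists a d c,
    [/\ 0 < d, a <= W, d <= W & forall j, j < k -> chi (a + j * d) = c].

(* Colour focusing: the progressions, one for each colour in X, would all
   have f as their next, (k+1)-st, term. *)
Definition focused (C : finType) (chi : nat -> C) (k W : nat) (X : {set C})
    (f : nat) : Prop :=
  forall c, c \in X -> exists a d,
    [/\ 0 < d, d <= W, a + k * d = f & forall j, j < k -> chi (a + j * d) = c].

(** Induction on [r]. Blocks of length [W.+1] are coloured by their whole patterns, so the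
    hypothesis gives [k] equally coloured blocks at distance [D]. A focused progression of the first
    block, its step [d] enlarged by [D] blocks, keeps its colour and is focused at position [f] of
    block [b + k * D]. *)
Lemma color_focusing (C : finType) (k r : nat) :
  (forall C' : finType, exists W, vdW_bound C' k W) ->
  exists W, forall chi : nat -> C,
    (exists a d c, [/\ 0 < d, a <= W, d <= W &
       forall j, j < k.+1 -> chi (a + j * d) = c]) \/
    (exists (X : {set C}) (f : nat),
       [/\ #|X| = r, f <= W & focused chi k W X f]).
Proof.
move=> vdWk; elim: r => [|r [W IH]].
  exists 0 => chi; right; exists finset.set0, 0; rewrite cards0; split=> // c.
  by rewrite inE.
have [N HN] := vdWk {ffun 'I_W.+1 -> C}.
exists ((N + k * N) * W.+1 + W) => chi.
have [b [D [c0 [D0 bN DN Hb]]]] :=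
  HN (fun b => [ffun i : 'I_W.+1 => chi (b * W.+1 + i)]).
have same j i : j < k -> i <= W ->
    chi ((b + j * D) * W.+1 + i) = chi (b * W.+1 + i).
  move=> jk iW; have k0 : 0 < k by apply: leq_ltn_trans jk.
  have := Hb _ jk; rewrite -(Hb _ k0) mul0n addn0.
  by move=> /ffunP /(_ (Ordinal (iW : i < W.+1))); rewrite !ffunE.
have [[a [d [c [d0 aW dW Hc]]]]|[X [f [Xr fW HX]]]] :=
    IH (fun i => chi (b * W.+1 + i)).
  left; exists (b * W.+1 + a), d, c; split=> //.
  - by nia.
  - by nia.
  - by move=> j jk; rewrite -addnA Hc.
(* Either position [f] of the first block completes a progression focused at it, or its copies in
   the [k] blocks form a focused progression in a new colour. *)
have [/HX [a [d [d0 dW adf Hc]]]|fX] := boolP (chi (b * W.+1 + f) \in X).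
  left; exists (b * W.+1 + a), d, (chi (b * W.+1 + f)); split=> //.
  - by nia.
  - by nia.
  - move=> j; rewrite ltnS leq_eqVlt => /predU1P[->|jk].
      by rewrite -addnA adf.
    by rewrite -addnA Hc.
right; exists (chi (b * W.+1 + f) |: X), ((b + k * D) * W.+1 + f); split.
- by rewrite cardsU1 fX Xr.
- by nia.
move=> c; rewrite !inE => /predU1P[->|/HX [a [d [d0 dW adf Hc]]]].
  exists (b * W.+1 + f), (D * W.+1); split.
  - by rewrite muln_gt0 D0.
  - by nia.
  - by nia.
  - move=> j jk; rewrite -(same j f) //; congr chi; nia.
exists (b * W.+1 + a), (D * W.+1 + d); split.
- by rewrite addn_gt0 d0 orbT.
- by nia.
- by nia.
- move=> j jk; rewrite -(Hc j jk) -(same j (a + j * d)) //; last by nia.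
  by congr chi; nia.
Qed.

Lemma van_der_Waerden (k : nat) (C : finType) : exists W, vdW_bound C k W.
Proof.
elim: k C => [|k IHk] C.
  by exists 1 => chi; exists 0, 1, (chi 0).
have [W HW] := @color_focusing C k #|C|.+1 IHk.
exists W => chi; have [//|[X [f [XC _ _]]]] := HW chi.
by have := max_card X; rewrite XC ltnn.
Qed.

(** * Pigeonhole and rounding *)

Lemma pigeonhole_unbounded (T : finType) (P : T -> nat -> Prop) :
  (forall x, exists t, P t x) ->
  exists t, forall x, exists2 y, x <= y & P t y.
Proof.
move=> HP; apply: contrapT => /forallNP H.
have /choice[g Hg] : forall t, exists x, forall y, x <= y -> ~ P t y.
  move=> t; have /existsNP[x Hx] := H t.
  by exists x => y xy Py; apply: Hx; exists y.
have [t Pt] := HP (\max_t g t).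
exact: (Hg t _ (leq_bigmax t)).
Qed.

Lemma ceil_div (m d : nat) : 0 < d ->
  exists u, m <= d * u /\ (u = 0 \/ 0 < m /\ d * u < m + d).
Proof.
move=> d0; exists ((m + d.-1) %/ d).
have := divn_eq (m + d.-1) d; have := ltn_pmod (m + d.-1) d0.
by case: (_ %/ _) => [|u]; nia.
Qed.

(** * Sets closed under interpolation in a fixed ratio *)

Section ThreePoints.
Variables (p q : nat).
Hypotheses (p0 : 0 < p) (q0 : 0 < q).
Local Notation n := (p + q).

(** [x + p * u] is the middle point of the copy of {0, p, n} with outer points [x] and
    [x + n * u]. *)
Definition ratio_closed (B : nat -> Prop) :=
  forall x u, B x -> B (x + n * u) -> B (x + p * u).

Variable B : nat -> Prop.
Hypothesis Bc : ratio_closed B.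

Local Notation inB a b := (forall z, a <= z <= b -> B z).

(* The points z = (q x + p y) / n with x in [a, b] and y in [c, e]: all
   integers in the interpolated interval, except within p q / n of its ends. *)
Lemma combine a b c e z :
  a + p <= b -> c + q <= e -> a <= c -> b <= e -> inB a b -> inB c e ->
  q * a + p * c + p * q <= n * z -> n * z + p * q <= q * b + p * e -> B z.
Proof.
move=> ab ce ac be Bab Bce lo hi.
have [zb|bz] := leqP z b; first by apply: Bab; nia.
suff [u [u1 u2 u3 u4]] : exists u,
    [/\ a + p * u <= z, z <= b + p * u, c <= z + q * u & z + q * u <= e].
  have -> : z = (z - p * u) + p * u by nia.
  by apply: Bc; [apply: Bab | apply: Bce]; nia.
(* [u1] and [u2] are the least [u] with [z <= b + p * u] and [c <= z + q * u]; their maximum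
   satisfies all four inequalities. *)
have [u1 [h1 h1']] := ceil_div (z - b) p0.
have [u2 [h2 h2']] := ceil_div (c - z) q0.
have [u12|/ltnW u21] := leqP u1 u2.
  exists u2; have pu : p * u1 <= p * u2 by rewrite leq_mul2l u12 orbT.
  have lo' : a + p * u2 <= z.
    case: h2' => [u20|[cz h2']]; first by rewrite u20 muln0; nia.
    have : p * (q * u2 + z) <= p * (c + q) by rewrite leq_mul2l; lia.
    by move=> H; rewrite -(leq_pmul2l q0); lia.
  by split; lia.
exists u1; have qu : q * u2 <= q * u1 by rewrite leq_mul2l u21 orbT.
have hi' : z + q * u1 <= e.
  case: h1' => [u10|[zb h1']]; first by rewrite u10 muln0; nia.
  have : q * (p * u1 + b) <= q * (z + p) by rewrite leq_mul2l; lia.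
  by move=> H; rewrite -(leq_pmul2l p0); lia.
by split; lia.
Qed.

(* Each step of the induction interpolates a new interval inside the gap: it
   shortens the gaps by the factor (n - 1) / n and costs at most 2 n in the
   lengths of the intervals. *)
Lemma fill j l g a b c e z :
  n * g + n * n <= l -> inB a b -> inB c e ->
  a + l + 2 * n * j <= b -> c + l + 2 * n * j <= e ->
  (c - b) * n.-1 ^ j <= n ^ j * g -> b <= z <= c -> B z.
Proof.
have pqn : p <= q * n by clear -p0 q0; nia.
have qpn : q <= p * n by clear -p0 q0; nia.
have pq1 : p * q + n <= q * (n * n) + 1 by clear -p0 q0; nia.
have pq2 : p * q + n <= p * (n * n) + 1 by clear -p0 q0; nia.
have pq3 : 2 * (p * q) <= n * n by clear; nia.
move=> gl; elim: j a b c e z => [|j IH] a b c e z Bab Bce ab ce.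
  rewrite !expn0 muln1 mul1n => gap /andP[bz zc].
  have ql : q * (n * g + n * n) <= q * l by rewrite leq_mul.
  have pl : p * (n * g + n * n) <= p * l by rewrite leq_mul.
  have qa : q * (a + l) <= q * b by rewrite leq_mul //; lia.
  have pe : p * (c + l) <= p * e by rewrite leq_mul //; lia.
  have pg : p * c <= p * (b + g) by rewrite leq_mul //; lia.
  have qg : q * c <= q * (b + g) by rewrite leq_mul //; lia.
  have nb : n * b <= n * z by rewrite leq_mul.
  have nc : n * z <= n * c by rewrite leq_mul.
  have gp : p * g <= (q * n) * g by rewrite leq_mul.
  have gq : q * g <= (p * n) * g by rewrite leq_mul.
  have nn : n <= n * n by rewrite leq_pmulr // ltn_addr.
  apply: (@combine a b c e) => //; clear - ab ce ql pl qa pe pg qg nb nc gp gq pq1 pq2 nn bz zc gl p0 q0; lia.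
move=> gap /andP[bz zc].
have nl : n * n <= l by lia.
have nn : 2 * n <= n * n by clear -p0 q0; nia.
have qa : q * (a + l + 2 * n * j.+1) <= q * b by rewrite leq_mul //; lia.
have pe : p * (c + l + 2 * n * j.+1) <= p * e by rewrite leq_mul //; lia.
have qnl : q * (n * n) <= q * l by rewrite leq_mul.
have pnl : p * (n * n) <= p * l by rewrite leq_mul.
have [z1 [lo lo']] := ceil_div (q * a + p * c + p * q) (ltn_addr q p0).
have := divn_eq (q * b + p * e - p * q) n.
have := ltn_pmod (q * b + p * e - p * q) (ltn_addr q p0).
set z2 := _ %/ n; set r := _ %% n => rn z2E.
have pqb : p * q <= q * b + p * e by clear -qa pe pnl pq2; lia.
have hi : n * z2 + p * q <= q * b + p * e by clear -rn z2E pqb; lia.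
have hi' : q * b + p * e < n * z2 + p * q + n by clear -rn z2E pqb; lia.
have lo'' : n * z1 < q * a + p * c + p * q + n.
  by case: lo' => [->|[_ //]]; rewrite muln0 ltn_addl // ltn_addr.
have {lo'} lo' : n * z1 <= q * b + p * c.
  case: lo' => [z10|[_ lo']]; last by clear -lo' qa qnl pq1; lia.
  by move: lo; rewrite z10 muln0; clear -p0 q0; nia.
have hi'' := hi'.
have {}hi' : q * b + p * c <= n * z2 by clear -hi' pe pnl pq2; lia.
have len : z1 + l + 2 * n * j <= z2.
  rewrite -(leq_pmul2l (ltn_addr q p0)).
  by clear -lo'' hi'' qa pe pq3 nn; lia.
have Bmid : inB z1 z2.
  move=> y /andP[y1 y2].
  have ny1 : n * z1 <= n * y by rewrite leq_mul.
  have ny2 : n * y <= n * z2 by rewrite leq_mul.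
  apply: (@combine a b c e) => //.
  1-4: by clear -ab ce nl bz zc nn; lia.
  1-2: by clear -lo ny1 ny2 hi; lia.
(* The new gaps are at most [p / n] and [q / n] times the old one, and [p] and [q] are at most
   [n.-1]. *)
have step G : n * G <= n.-1 * (c - b) -> G * n.-1 ^ j <= n ^ j * g.
  move=> nG; rewrite -(leq_pmul2l (ltn_addr q p0)) !mulnA -expnS.
  by apply: leq_trans gap; rewrite expnS mulnA [_ * n.-1]mulnC leq_mul.
have [zz1|zz1] := leqP z z1.
  apply: (IH a b z1 z2) => //; [by clear -ab; lia | | by rewrite bz].
  apply: step; apply: (@leq_trans (p * (c - b))).
    by rewrite !mulnBr; clear -lo' bz zc; nia.
  by rewrite leq_mul //; clear -q0; lia.
have [zz2|zz2] := leqP z z2; first by apply: Bmid; rewrite zz2 ltnW.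
apply: (IH z1 z2 c e) => //; [by clear -ce; lia | | by rewrite zc ltnW].
apply: step; apply: (@leq_trans (q * (c - b))).
  by rewrite !mulnBr; clear -hi'; lia.
by rewrite leq_mul //; clear -p0; lia.
Qed.

(** For [m > 0], [(1 + 1/m)^j >= 1 + j/m] by Bernoulli, so [j = m * k] suffices. *)
Lemma bernoulli_ratio m k : exists j, k * m ^ j <= m.+1 ^ j.
Proof.
have bern j : (m + j) * m ^ j <= m * m.+1 ^ j.
  elim: j => [|j IH]; first by rewrite addn0 !expn0.
  have : m.+1 * ((m + j) * m ^ j) <= m.+1 * (m * m.+1 ^ j) by rewrite leq_mul.
  rewrite !expnS; set x := m ^ j; set y := m.+1 ^ j => H.
  rewrite [leqRHS]mulnCA; apply: leq_trans H.
  by rewrite !mulnA leq_mul //; clear; nia.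
have [->|m0] := posnP m; first by exists 1; rewrite expn1 muln0.
exists (m * k); rewrite -(leq_pmul2l m0); apply: leq_trans (bern _).
by rewrite mulnA leq_mul // leq_addl.
Qed.

(** [fill] needs two long intervals, but the anchor is short: interpolating it with [[x, y]] gives a
    long [[x1, y1]], and [fill] closes any gap from there to [x]. The gap is at most a constant
    times [y - x], so the number [j] of rounds depends only on [D] and [n]. *)
Lemma extend_left a0 D : inB a0 (a0 + n) ->
  exists X, forall x y, X <= x -> x <= D * (y - x) -> inB x y -> B x.-1.
Proof.
move=> Banchor.
have [D0|D0] := posnP D; first by exists 1 => x y x0; rewrite D0; lia.
(* [E] makes [g = x %/ E] small against the length [Y], while [x <= 2 * E * g]; then [j] rounds
   shrink a gap of [2 * E * g] to [g]. *)
pose E := 4 * (n * n) * D.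
have [j Hj] := bernoulli_ratio n.-1 (2 * E).
have nE : n.-1.+1 = n by lia.
rewrite nE in Hj.
pose c0 := n * (n * n) + n * (2 * n * j) + n * n + 2 * n.
exists (D * (2 * c0) + E + a0 + 3 * n + 1) => x y Xx xY Bxy.
have E0 : 0 < E by rewrite !muln_gt0 D0; clear -p0; lia.
have [Y yE] : exists Y, y = x + Y.
  exists (y - x); rewrite subnKC //; case: leqP => // /ltnW; rewrite -subn_eq0.
  by move=> /eqP H; move: xY; rewrite H; clear -Xx; lia.
subst y; rewrite addKn in xY.
have Yc0 : 2 * c0 <= Y by rewrite -(leq_pmul2l D0); clear -xY Xx; lia.
have := divn_eq x E; have := ltn_pmod x E0.
set g := x %/ E; set r := x %% E => rE gE.
have g0 : 0 < g by rewrite divn_gt0 //; clear -Xx; lia.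
have Eg : E <= g * E by rewrite leq_pmull.
have xg : x <= (2 * E) * g by clear -gE rE Eg; lia.
have gY : 4 * (n * n) * g <= Y.
  rewrite -(leq_pmul2l D0); apply: leq_trans xY.
  by rewrite gE /E; clear; lia.
have c0E := erefl c0; rewrite {2}/c0 in c0E.
have pq : p * q <= n * n by rewrite leq_mul // ?leq_addr ?leq_addl.
have nn : 2 * n <= n * n by rewrite leq_mul //; clear -p0 q0; lia.
have [x1 [lo lo']] := ceil_div (q * a0 + p * x + p * q) (ltn_addr q p0).
have {lo'} lo' : n * x1 < q * a0 + p * x + p * q + n.
  by case: lo' => [->|[_ //]]; rewrite muln0 ltn_addl // ltn_addr.
have := divn_eq (q * a0 + p * (x + Y)) n.
have := ltn_pmod (q * a0 + p * (x + Y)) (ltn_addr q p0).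
set y1 := _ %/ n; set s := _ %% n => sn y1E.
have pY : Y <= p * Y by rewrite leq_pmull.
have len : x1 + (n * g + n * n) + 2 * n * j <= y1.
  rewrite -(leq_pmul2l (ltn_addr q p0)).
  clear -lo' y1E sn pY gY Yc0 c0E pq; lia.
have B1 : inB x1 y1.
  move=> z /andP[z1 z2].
  have nz1 : n * x1 <= n * z by rewrite leq_mul.
  have nz2 : n * z <= n * y1 by rewrite leq_mul.
  apply: (@combine a0 (a0 + n) x (x + Y)) => //.
  - by clear; lia.
  - by clear -Yc0 c0E; lia.
  - by clear -Xx; lia.
  - by clear -Xx; lia.
  - by clear -lo nz1; lia.
  - by clear -nz2 y1E; lia.
have x1x : x1 <= x.-1.
  rewrite -(leq_pmul2l (ltn_addr q p0)).
  have qx : q * (a0 + p + 2 * n) <= q * x by rewrite leq_mul //; clear -Xx; lia.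
  have qn : 2 * n <= q * (2 * n) by rewrite leq_pmull.
  have -> : n * x.-1 = n * x - n by rewrite -subn1 mulnBr muln1.
  by clear -qx qn lo'; lia.
have [xy1|xy1] := leqP x.-1 y1; first by apply: B1; rewrite x1x.
apply: (@fill j (n * g + n * n) g x1 y1 x (x + Y)) => //.
- have ng : n * g <= n * n * g by rewrite leq_mul // leq_pmulr // ltn_addr.
  have nj : 2 * n * j <= n * (2 * n * j) by rewrite leq_pmull // ltn_addr.
  by clear -gY Yc0 c0E ng nj; lia.
- apply: leq_trans (_ : x * n.-1 ^ j <= _); first by rewrite leq_mul // leq_subr.
  apply: leq_trans (leq_mul xg (leqnn _)) _.
  by rewrite mulnAC leq_mul.
- by rewrite ltnW //= leq_pred.
Qed.

Lemma eventually_all D :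
  (forall X, exists x y, [/\ X <= x, x <= D * (y - x) & inB x y]) ->
  exists X, forall t, X <= t -> B t.
Proof.
(* Starting beyond [D * n] forces a length above [n], enough for the anchor. *)
move=> HB; have [a0 [b [Xa0 aD Bab]]] := HB (D * n).+1.
have anchor : inB a0 (a0 + n).
  move=> z /andP[z1 z2]; apply: Bab; rewrite z1 (leq_trans z2) //.
  have : n < b - a0 by rewrite ltnNge; apply/negP => H; nia.
  by lia.
have [X HX] := extend_left D anchor; exists X => t Xt.
(* An interval beyond [t] is extended point by point; [y] stays fixed, so [x <= D * (y - x)]
   persists as [x] decreases. *)
have [x [y [tx xD Bxy]]] := HB t.+1.
have xy : x <= y by nia.
have {}HX d : X <= x - d -> inB (x - d) y.
  elim: d => [|d IH]; first by rewrite subn0.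
  move=> Xd; have Xd' : X <= x - d by lia.
  move=> z /andP[]; rewrite leq_eqVlt => /predU1P[<- _|z1 z2].
    rewrite subnS; apply: (HX _ y) => //; last exact: IH.
    apply: leq_trans (leq_subr _ _) (leq_trans xD _).
    by rewrite leq_mul //; lia.
  by apply: IH => //; lia.
by apply: (HX (x - t)); lia.
Qed.

(* One level of refinement replaces t by a combination of two multiples of n:
   t = p u + n v lies on the segment from n v to n (v + u), and u exists
   because p is invertible modulo n. *)
Lemma subdivide s x m lo hi : coprime p n ->
  (forall t, lo <= t <= hi -> B (x + m * (n ^ s * t))) ->
  forall t, n ^ s * (lo + 2 * p) <= t -> t + n ^ s * (2 * q) <= n ^ s * hi ->
    B (x + m * t).
Proof.
move=> pn; have n0 : 0 < n by rewrite ltn_addr.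
have n2 : 1 < n by lia.
elim: s lo hi => [|s IH] lo hi HB t.
  rewrite expn0 !mul1n => t1 t2; rewrite -[t]mul1n; apply: HB.
  by apply/andP; split; lia.
(* The margins [p * n] and [q * n] leave room for the [u < n] below. Over all levels they add up to
   at most [2 * p] and [2 * q] coarse steps, since [p * n + 2 * p <= 2 * p * n]. *)
move=> t1 t2; apply: (IH (n * lo + p * n) (n * hi - q * n)).
- move=> {t1 t2}t /andP[t1 t2].
  have [u un /eqP ut] : exists2 u, u < n & p * u == t %[mod n].
    case: (egcdnP n p0) => e1 e2 e _; rewrite (eqP pn) in e.
    exists ((e1 * t) %% n); first exact: ltn_pmod.
    by rewrite modnMmr mulnA [p * _]mulnC e mulnDl mul1n mulnAC modnMDl.
  have put : p * u <= t.
    by apply: leq_trans t1; rewrite (leq_trans _ (leq_addl _ _)) // leq_mul // ltnW.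
  have [v vE] : exists v, t = p * u + n * v.
    exists ((t - p * u) %/ n); rewrite [n * _]mulnC divnK ?subnKC //.
    by rewrite -eqn_mod_dvd //; apply/eqP.
  have pun : p * u <= p * n by rewrite leq_mul // ltnW.
  have qun : q * u <= q * n by rewrite leq_mul // ltnW.
  have v1 : lo <= v by rewrite -(leq_pmul2l n0); clear -vE t1 pun; lia.
  have v2 : v + u <= hi.
    by rewrite -(leq_pmul2l n0); clear -vE t2 t1 qun n0 p0; lia.
  have -> : x + m * (n ^ s * t) =
            (x + m * (n ^ s.+1 * v)) + p * (m * n ^ s * u).
    by rewrite vE expnS; clear; lia.
  apply: Bc; first by apply: HB; clear -v1 v2; lia.
  have -> : (x + m * (n ^ s.+1 * v)) + n * (m * n ^ s * u) =
            x + m * (n ^ s.+1 * (v + u)).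
    by rewrite expnS; clear; lia.
  by apply: HB; clear -v1 v2; lia.
- apply: leq_trans t1; rewrite expnSr -mulnA leq_mul //.
  by clear -n2; nia.
- rewrite expnSr in t2; rewrite mulnBr.
  have : n ^ s * (2 * q) <= n ^ s * (q * n) by rewrite leq_mul // mulnC leq_mul.
  by clear -t2; lia.
Qed.

End ThreePoints.

(** * Infinite monochromatic progressions *)

Lemma monochromatic_AP_of_ratio_closed (C : finType) (p q : nat) (chi : nat -> C) :
  0 < p -> 0 < q -> coprime p (p + q) ->
  (forall c, ratio_closed p q (fun x => chi x = c)) ->
  exists a d c, 0 < d /\ forall j, chi (a + j * d) = c.
Proof.
move=> p0 q0 pq Hchi; set n := p + q.
have n1 : 1 < n by rewrite /n; lia.
(* [subdivide] trims [2 * p] and [2 * q] coarse steps from the ends; of [2 * n + 1] steps one is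
   left, refined into [N] steps of size [m]. *)
have [W HW] := van_der_Waerden (2 * n).+2 C.
pose P (t : 'I_W.+1 * 'I_W.+1 * C) X :=
  0 < t.1.1 /\ exists x y, [/\ X <= x, x <= (W + 2 * n) * (y - x) &
    forall z, x <= z <= y -> chi (t.1.2 + t.1.1 * z) = t.2].
have [X|[[m a] c] Pt] := @pigeonhole_unbounded _ P.
  pose N := n ^ X; have XN : X < N by apply: ltn_expl.
  have [i [m [c [m0 iW mW Hc]]]] := HW (fun x => chi (N * x)).
  have aW : (i * N) %% m < W.+1.
    by rewrite ltnS ltnW // (leq_trans _ mW) // ltn_pmod.
  exists ((Ordinal (mW : m < W.+1), Ordinal aW), c); split=> //=.
  have := divn_eq (i * N) m; set e := _ %/ m; set a := _ %% m => iNE.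
  exists (e + N * (2 * p)), (e + N * (2 * p).+1); split.
  - apply: leq_trans (ltnW XN) (leq_trans _ (leq_addl _ _)).
    by rewrite leq_pmulr // muln_gt0.
  - rewrite subnDl -mulnBr subSnn muln1 mulnDl leq_add //.
      by apply: leq_trans (leq_div _ _) _; rewrite leq_mul.
    by rewrite mulnC leq_mul // leq_mul // leq_addr.
  move=> z /andP[z1 z2].
  have -> : a + m * z = i * N + m * (z - e) by rewrite iNE; nia.
  apply: (@subdivide p q p0 q0 _ (Hchi c) X (i * N) m 0 (2 * n).+1 pq).
  - move=> t /= tn; rewrite -(Hc t) //; congr chi; rewrite -/n -/N; lia.
  - by rewrite -/n -/N; lia.
  - by rewrite -/n -/N /n; lia.
have m0 : 0 < m by have [y _ []] := Pt 0.
have Bc : ratio_closed p q (fun z => chi (a + m * z) = c).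
  move=> x u /= B1 B2.
  have -> : a + m * (x + p * u) = (a + m * x) + p * (m * u) by lia.
  by apply: Hchi => //; rewrite -B2; congr chi; lia.
have [X|X HX] := @eventually_all p q p0 q0 _ Bc (W + 2 * n).
  have [Y XY [_ [x [y [Yx xD Hxy]]]]] := Pt X.
  by exists x, y; split=> //; apply: leq_trans XY Yx.
exists (a + m * X), m, c; split=> // j.
by rewrite -(HX (X + j)) ?leq_addr //; congr chi; lia.
Qed.

Lemma monochromatic_AP_of_right_extension (C : finType) (w : nat) (chi : nat -> C) :
  (forall x d c, 0 < d -> (forall j, j < w -> chi (x + j * d) = c) ->
     chi (x + w * d) = c) ->
  exists a d c, 0 < d /\ forall j, chi (a + j * d) = c.
Proof.
move=> ext; have [W HW] := van_der_Waerden w C.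
have [a [d [c [d0 _ _ Hc]]]] := HW chi.
exists a, d, c; split=> //; elim/ltn_ind => j IH.
have [/Hc//|wj] := ltnP j w.
have -> : a + j * d = a + (j - w) * d + w * d by rewrite -addnA -mulnDl subnK.
by apply: ext => // i iw; rewrite -addnA -mulnDl IH //; lia.
Qed.

Lemma monochromatic_AP_of_left_extension (C : finType) (w : nat) (chi : nat -> C) :
  0 < w ->
  (forall x d c, 0 < d -> (forall j, j < w -> chi (x + j.+1 * d) = c) ->
     chi x = c) ->
  exists a d c, 0 < d /\ forall j, chi (a + j * d) = c.
Proof.
move=> w0 ext; have [W HW] := van_der_Waerden w C.
pose P (t : 'I_W.+1 * 'I_W.+1 * C) X :=
  0 < t.1.1 /\ forall j, t.1.2 + j * t.1.1 <= X -> chi (t.1.2 + j * t.1.1) = t.2.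
have [X|[[d r] c] Pt] := @pigeonhole_unbounded _ P.
  have [a [d [c [d0 aW dW Hc]]]] := HW (fun x => chi (X + x)).
  have rW : (X + a) %% d < W.+1 by rewrite ltnS ltnW // (leq_trans _ dW) // ltn_pmod.
  exists ((Ordinal (dW : d < W.+1), Ordinal rW), c); split=> //= j.
  have := divn_eq (X + a) d; set b := _ %/ d; set r := _ %% d => XE rX.
  have down m : m <= b -> forall i, i < w -> chi (r + (b - m + i) * d) = c.
    elim: m => [_ i iw|m IH mb [|i] iw].
    - by rewrite subn0 -(Hc i iw); congr chi; lia.
    - rewrite addn0; apply: (ext _ d) => // k kw.
      by rewrite -(IH (ltnW mb) k kw); congr chi; nia.
    - by rewrite -(IH (ltnW mb) i (ltnW iw)); congr chi; nia.
  have jb : j <= b by rewrite -(leq_pmul2r d0); lia.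
  by have := down _ (leq_subr j b) 0 w0; rewrite addn0 subKn.
have d0 : 0 < d by have [y _ []] := Pt 0.
exists r, d, c; split=> // j.
have [Y XY [_ HY]] := Pt (r + j * d); exact: HY.
Qed.

Import Order.TTheory GRing.Theory Num.Theory.
Local Open Scope classical_set_scope.
Local Open Scope ring_scope.

(** * The logarithmic colouring of the reals *)

Lemma log_colouring (R : realType) (rho : R) : 0 < rho -> rho < 1 ->
  exists (M : nat) (f : R -> 'I_M.+1),
  (forall x1 x2 x3, 0 < x1 -> x1 < x3 -> rho * (x3 - x1) <= x2 - x1 ->
     rho * (x3 - x1) <= x3 - x2 -> f x1 = f x3 -> f x2 = f x3 ->
     forall z, x1 <= z <= x3 -> f z = f x3) /\
  (forall b t, 0 < t -> t <= b -> ~ forall m : nat, f (b + m%:R * t) = f b).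
Proof.
move=> rho0 rho1; pose eps := rho / 2; pose mu := 1 - rho / 2.
have eps0 : 0 < eps by rewrite /eps; lra.
have eps1 : eps < 2^-1 by rewrite /eps; lra.
have mu0 : 0 < mu by rewrite /mu; lra.
have lnmu : ln mu < 0 by apply: ln_lt0; rewrite mu0 /mu; lra.
(* Blocks have unit length in [h], so two points of one block have ratio above [mu]. *)
pose h x : R := ln x / - ln mu.
(* Points of ratio at least [eps] have [h] less than [M + 1] apart, so with [M.+3] colours a common
   colour means a common block. *)
pose M := Num.truncn (- h eps).
have MP : - h eps < M.+1%:R by apply: truncnS_gt.
pose fl x := Num.floor (h x).
have flE x : (fl x)%:~R <= h x < (fl x + 1)%:~R by apply: floor_itv.
pose f x : 'I_M.+3 := inord `|(fl x %% M.+3)%Z|%N.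
have f_dvd x y : f x = f y -> (M.+3 %| fl x - fl y)%Z.
  have m0 z : (0 <= z %% M.+3)%Z by apply: modz_ge0.
  have mlt z : (`|(z %% M.+3)%Z| < M.+3)%N.
    by rewrite -ltz_nat gez0_abs // ltz_pmod.
  move=> /(congr1 val); rewrite /= !inordK // => E.
  by rewrite -eqz_mod_dvd -[X in X == _]gez0_abs // -[X in _ == X]gez0_abs // E.
have h_mono x y : 0 < x -> x <= y -> h x <= h y.
  move=> x0 xy; rewrite /h ler_pM2r ?invr_gt0 ?oppr_gt0 //.
  by rewrite ler_ln // posrE // (lt_le_trans x0).
have fl_mono x y : 0 < x -> x <= y -> fl x <= fl y.
  by move=> x0 xy; apply: le_floor; apply: h_mono.
have same_fl x y : 0 < x -> x <= y -> eps * y <= x -> f x = f y -> fl x = fl y.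
  move=> x0 xy exy /f_dvd; have y0 := lt_le_trans x0 xy.
  have : h (eps * y) <= h x by apply: h_mono => //; apply: mulr_gt0.
  rewrite /h lnM ?posrE // mulrDl -/(h x) -/(h y) -/(h eps) => hxy.
  have := fl_mono _ _ x0 xy; have /andP[_ xu] := flE x; have /andP[yl _] := flE y.
  rewrite le_eqVlt => /predU1P[//|flxy].
  rewrite dvdzE /= => /dvdn_leq; rewrite absz_gt0 subr_eq0 lt_eqF // => /(_ isT) H.
  have : fl x + M.+3%:Z <= fl y.
    by move: H; rewrite -lez_nat ltz0_abs ?subr_lt0 // opprB lerBrDl.
  rewrite -(ler_int R) => {}H.
  rewrite !intrD in H xu; rewrite -natr1 in MP.
  have e : (M.+3%:Z)%:~R = M%:R + 3 :> R by rewrite -pmulrn -!natr1; ring.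
  by rewrite e in H; exfalso; lra.
have close x y : 0 < x -> x <= y -> fl x = fl y -> mu * y < x.
  move=> x0 xy Exy; have y0 := lt_le_trans x0 xy.
  rewrite -ltr_ln ?posrE ?mulr_gt0 // lnM ?posrE //.
  have /andP[xl _] := flE x; have /andP[_ yu] := flE y.
  rewrite -Exy intrD in yu.
  have : h y < h x + 1 by lra.
  rewrite /h -(ltr_pM2r (_ : 0 < - ln mu)) ?oppr_gt0 // mulrDl mul1r.
  rewrite !divfK ?oppr_eq0 ?lt_eqF //; lra.
exists M.+2, f; split.
- move=> x1 x2 x3 x10 x13 lo hi f13 f23.
  have x12 : x1 <= x2 by rewrite -subr_ge0; apply: le_trans lo; rewrite mulr_ge0 ?subr_ge0 // ltW.
  have x23 : x2 <= x3 by rewrite -subr_ge0; apply: le_trans hi; rewrite mulr_ge0 ?subr_ge0 // ltW.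
  have x20 := lt_le_trans x10 x12.
  have rx1 : rho * x1 <= x1 by rewrite ler_piMl // ltW.
  have rx3 : rho * x1 <= rho * x3 by rewrite ler_pM2l // ltW.
  have e23 : fl x2 = fl x3.
    apply: same_fl => //; rewrite /eps; nra.
  have m23 := close _ _ x20 x23 e23.
  have e13 : fl x1 = fl x3.
    (* If [x1 < eps * x3], then [x3 - x2 > rho * (1 - eps) * x3 > (rho / 2) * x3], against
       [mu * x3 < x2]. *)
    have [|ex] := leP (eps * x3) x1; first by move=> ?; apply: same_fl => //; exact: ltW.
    rewrite /eps /mu in ex m23; exfalso; nra.
  move=> z /andP[z1 z3].
  have z0 := lt_le_trans x10 z1.
  have -> // : f z = f x3.
  suff e : fl z = fl x3 by rewrite /f e.
  by apply/eqP; rewrite eq_le fl_mono // -e13 fl_mono.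
- move=> b t t0 tb H.
  have b0 := lt_le_trans t0 tb.
  (* As [t <= b], consecutive terms have ratio at least 1/2, which exceeds [eps], so all terms lie
     in one block; but a block is bounded. *)
  have fb m : fl (b + m%:R * t) = fl b.
    elim: m => [|m IH]; first by rewrite mul0r addr0.
    rewrite -IH; apply/esym; apply: same_fl; rewrite ?H //.
    + by rewrite ltr_wpDr // mulr_ge0 // ltW.
    + by rewrite -natr1; lra.
    + have mt : 0 <= m%:R * t by rewrite mulr_ge0 // ltW.
      rewrite -natr1 mulrDl mul1r; nra.
  pose m := Num.truncn (b / (mu * t)).
  have mP : b / (mu * t) < m.+1%:R by apply: truncnS_gt.
  have mt : 0 < mu * t by apply: mulr_gt0.
  rewrite ltr_pdivrMr // in mP.
  have := close _ _ b0 _ (esym (fb m.+1)).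
  have H1 : 0 <= m.+1%:R * t by rewrite mulr_ge0 // ltW.
  rewrite lerDl H1 => /(_ isT); nra.
Qed.

Lemma not_extreme_between (S : {fset int}) (s0 : int) : s0 \in S -> ~ extreme_point S s0 ->
  exists l r, [/\ l \in S, r \in S, l < s0 & s0 < r].
Proof.
move=> s0S ext.
have /existsNP[l /not_implyP[lS /negP]] : ~ forall s, s \in S -> s0 <= s.
  by move=> H; apply: ext; split; [|left].
have /existsNP[r /not_implyP[rS /negP]] : ~ forall s, s \in S -> s <= s0.
  by move=> H; apply: ext; split; [|right].
by rewrite -!ltNge => s0r ls0; exists l, r.
Qed.

Lemma exists_outside_three (S : {fset int}) (a b c : int) : (3 < #|` S|)%N ->
  exists2 t, t \in S & t \notin [:: a; b; c].
Proof.
move=> S3; apply: contrapT => H.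
suff : (#|` S| <= 3)%N by rewrite leqNgt S3.
apply: (@uniq_leq_size _ _ [:: a; b; c]); first exact: fset_uniq.
by move=> t tS; apply: contrapT => /negP tN; apply: H; exists t.
Qed.

(** The fourth point enters here: wherever [t] falls, sorting [l], [r] and [t] gives three points
    other than [s0], with [s0] strictly between the outer two. *)
Lemma three_points_around (S : {fset int}) (s0 : int) : s0 \in S ->
  (3 < #|` S|)%N -> ~ extreme_point S s0 ->
  exists s1 s2 s3 : int, [/\ s1 \in S, s2 \in S & s3 \in S] /\
    [/\ s1 < s2, s2 < s3, s1 < s0, s0 < s3 & s2 != s0].
Proof.
move=> s0S S3 /(not_extreme_between s0S)[l [r [lS rS ls0 s0r]]].
have [t tS] := exists_outside_three l s0 r S3.
rewrite !inE !negb_or => /and3P[tl ts0 tr].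
have [ltl|ltl] := ltP t l; first by exists t, l, r; do 2!split=> //; lia.
have [ltr|ltr] := ltP t r; first by exists l, t, r; do 2!split=> //; lia.
by exists l, r, t; do 2!split=> //; lia.
Qed.

Lemma colouring_of_reals (R : realType) (S : {fset int}) (s0 : int) :
  s0 \in S -> (3 < #|` S|)%N -> ~ extreme_point S s0 ->
  exists (k : nat) (chi : R -> 'I_k),
    AP_free (fun x : R => x) chi /\ AM_copy_free (fun x : R => x) chi S s0.
Proof.
move=> s0S S3 ext.
have [s1 [s2 [s3 [[s1S s2S s3S] [s12 s23 s10 s03 s20]]]]] :=
  three_points_around s0S S3 ext.
pose w : R := (s3 - s1)%:~R.
have w1 : 1 < w by rewrite /w ltr1z; lia.
have w0 : 0 < w by lra.
(* In a copy of scale [l], distinct points are at least [l] apart and the images of [s1] and [s3]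
   are [w * l] apart, whence the ratio [w^-1]. *)
have [||M [f [f_block f_AP]]] := @log_colouring R w^-1.
- by rewrite invr_gt0.
- by rewrite invf_lt1.
pose chi x := enum_rank (0 < x, x < 0, f `|x|).
have chiE x y : chi x = chi y ->
    [/\ (0 < x) = (0 < y), (x < 0) = (y < 0) & f `|x| = f `|y|].
  by move=> /enum_rank_inj[].
exists #|{: bool * bool * 'I_M.+1}|, chi; split.
- move=> A [a [t [t0]]]; rewrite [X in X = _]image_id => -> [c Hc].
  have {}Hc (m : nat) : chi (a + m%:R * t) = c by apply: Hc; exists m.
  (* From index [m0] on, the terms keep the sign of [t] and exceed [t] in modulus, as [f_AP]
     requires. *)
  pose m0 := (Num.truncn (`|a| / `|t|)).+2.
  have nt0 : 0 < `|t| by rewrite normr_gt0.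
  have m0P : `|a| < (m0%:R - 1) * `|t|.
    by rewrite -ltr_pdivrMr // -natr1 addrK; apply: truncnS_gt.
  have na : - `|a| <= a <= `|a| by rewrite -ler_norml.
  have Hf m : f `|a + m0%:R * t + m%:R * t| = f `|a + m0%:R * t|.
    rewrite -addrA -mulrDl -natrD.
    by have /chiE[] : chi (a + (m0 + m)%:R * t) = chi (a + m0%:R * t) by rewrite !Hc.
  have mt m : 0 <= m%:R * `|t| by rewrite mulr_ge0.
  apply: (f_AP (`|a + m0%:R * t|) `|t| nt0).
    have [tp|tn] := ger0P t; rewrite ?(ger0_norm tp) ?(ltr0_norm tn) in m0P *.
      by apply: le_trans (ler_norm _); lra.
    by rewrite -normrN; apply: le_trans (ler_norm _); lra.
  move=> m; rewrite -(Hf m); congr f; move: (mt m).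
  have [tp|tn] := ger0P t; rewrite ?(ger0_norm tp) ?(ltr0_norm tn) in m0P * => mt'.
    by rewrite !ger0_norm; clear -m0P na mt' tp; lra.
  by rewrite !ler0_norm; clear -m0P na mt' tn; lra.
- move=> T t0 [c [l [l0]]]; rewrite [X in X = _]image_id => TE t0E [Tt0 [col Hcol] Tmono].
  pose x (s : int) : R := c + l * s%:~R.
  have xT s : s \in S -> T (x s).
    by move=> sS; rewrite TE; exists s%:~R => //; exists s.
  have x_inj s : s != s0 -> x s <> t0.
    rewrite t0E => ss0 /addrI /(mulfI (lt0r_neq0 l0)) /intr_inj; exact/eqP.
  have Hx s : s \in S -> s != s0 -> chi (x s) = col.
    by move=> sS ss0; apply: Hcol; split; [exact: xT | exact: x_inj].
  have Hx1 : chi (x s1) = col by apply: Hx => //; rewrite lt_eqF.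
  have Hx2 : chi (x s2) = col by apply: Hx.
  have Hx3 : chi (x s3) = col by apply: Hx => //; rewrite gt_eqF.
  have x13 : x s1 < x s3 by rewrite ltrD2l ltr_pM2l // ltr_int (lt_trans s10).
  have x10 : x s1 <= t0 by rewrite t0E lerD2l ler_pM2l // ler_int ltW.
  have x03 : t0 <= x s3 by rewrite t0E lerD2l ler_pM2l // ler_int ltW.
  have xB s s' : x s' - x s = l * (s' - s)%:~R by rewrite /x intrB; ring.
  have wx13 : w^-1 * (x s3 - x s1) = l by rewrite xB -/w mulrCA mulVf ?mulr1 ?gt_eqF.
  have gap s s' : s < s' -> l <= x s' - x s.
    by move=> ss; rewrite xB ler_peMr ?(ltW l0) // ler1z -gtz0_ge1 subr_gt0.
  have [p13 n13 f13] := chiE _ _ (etrans Hx1 (esym Hx3)).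
  have [p23 n23 f23] := chiE _ _ (etrans Hx2 (esym Hx3)).
  apply: Tmono; exists col => y Ty.
  have [->|/eqP yt0] := eqVneq y t0; last by apply: Hcol; split.
  rewrite -Hx3 /chi.
  have [x1p|x1n|x1z] := ltrgtP 0 (x s1).
  + have x2p : 0 < x s2 by rewrite p23 -p13.
    have x3p : 0 < x s3 by rewrite -p13.
    have t0p : 0 < t0 := lt_le_trans x1p x10.
    rewrite x3p t0p (lt_gtF x3p) (lt_gtF t0p).
    rewrite !gtr0_norm // in f13 f23 *; congr (enum_rank (_, _, _)).
    apply: (f_block (x s1) (x s2)); rewrite ?wx13 ?gap //.
    by rewrite x10.
  + have x2n : x s2 < 0 by rewrite n23 -n13.
    have x3n : x s3 < 0 by rewrite -n13.
    have t0n : t0 < 0 := le_lt_trans x03 x3n.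
    rewrite x3n t0n (lt_gtF x3n) (lt_gtF t0n).
    rewrite !ltr0_norm // in f13 f23 *; congr (enum_rank (_, _, _)).
    rewrite -f13; apply: (f_block (- x s3) (- x s2)).
    * by rewrite oppr_gt0.
    * by rewrite ltrN2.
    * by rewrite !opprK ![- _ + _]addrC wx13 gap.
    * by rewrite !opprK ![- _ + _]addrC wx13 gap.
    * by rewrite f13.
    * by rewrite f23 f13.
    * by rewrite !lerN2 x10 x03.
  + by move: p13; rewrite -x1z ltxx x1z x13.
Qed.

(** * Restriction to the naturals *)

Lemma restrict_to_nat (R : realType) (k : nat) (chi : R -> 'I_k)
    (S : {fset int}) (s0 : int) :
  AP_free (fun x : R => x) chi -> AM_copy_free (fun x : R => x) chi S s0 ->
  let j (n : nat) : R := n%:R in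
  AP_free j (chi \o j) /\ AM_copy_free j (chi \o j) S s0.
Proof.
move=> APf AMf j.
have monoE A : monochromatic (chi \o j) A <-> monochromatic chi (j @` A).
  split=> -[c Hc]; exists c => x.
    by move=> [n An <-]; exact: Hc.
  by move=> Ax; apply: Hc; exists x.
split.
- move=> A AP /monoE; apply: APf; by rewrite [X in infinite_AP X]image_id.
- move=> T t0 copy [Tt0 Tmono TN]; apply: (AMf (j @` T) (j t0)).
    by rewrite [X in positive_homothetic_copy _ _ X]image_id.
  split; [by exists t0 | | by move=> /monoE].
  case: Tmono => c Hc; exists c => x [[n Tn <-] nt0].
  by apply: Hc; split=> // nt; apply: nt0; rewrite nt.
Qed.

(** * Necessity of the condition *)

Section ColouringsOfNat.
Variables (R : realType) (k : nat) (chi : nat -> 'I_k) (S : {fset int}) (s0 : int).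

Lemma AP_free_nat : AP_free (fun n : nat => n%:R : R) chi ->
  ~ exists a d c, (0 < d)%N /\ forall j, chi (a + j * d)%N = c.
Proof.
move=> APf [a [d [c [d0 Hc]]]].
apply: (APf [set (a + j * d)%N | j in [set: nat]]).
  exists a%:R, d%:R; rewrite pnatr_eq0 -lt0n d0; split=> //.
  rewrite image_comp; apply: eq_imagel => j _ /=; by rewrite natrD natrM.
by exists c => _ [j _ <-].
Qed.

Hypothesis s0S : s0 \in S.

Lemma AM_copy_free_nat (x : int -> nat) (a : int) (d : nat) (c : 'I_k) :
  AM_copy_free (fun n : nat => n%:R : R) chi S s0 -> (0 < d)%N ->
  (forall s, s \in S -> (x s)%:Z = a + d%:Z * s) ->
  (exists2 s, s \in S & s != s0) ->
  (forall s, s \in S -> s != s0 -> chi (x s) = c) -> chi (x s0) = c.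
Proof.
move=> AMf d0 xE [s1 s1S s10] Hc; apply: contrapT => Hx0.
have xR s : s \in S -> (x s)%:R = a%:~R + d%:R * s%:~R :> R.
  by move=> sS; rewrite pmulrn xE // intrD intrM.
apply: (AMf [set x s | s in [set` S]] (x s0)).
  exists a%:~R, d%:R; rewrite ltr0n d0 xR //; split=> //.
  rewrite !image_comp; apply: eq_imagel => s sS /=; exact: xR.
split; first by exists s0.
- exists c => _ [[s sS <-] xs]; apply: Hc => //.
  by apply/eqP => ss; apply: xs; rewrite ss.
- move=> [c' Hc']; apply: Hx0.
  rewrite (Hc' (x s0)); last by exists s0.
  by rewrite -(Hc' (x s1)); [apply: Hc | exists s1].
Qed.

End ColouringsOfNat.

Lemma only_three_points (S : {fset int}) (a b c t : int) :
  (#|` S| <= 3)%N -> a < b -> b < c -> a \in S -> b \in S -> c \in S ->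
  t \in S -> t \in [:: a; b; c].
Proof.
move=> S3 ab bc aS bS cS tS; apply: contraLR S3 => tN; rewrite -ltnNge.
apply: (@uniq_leq_size _ [:: t; a; b; c]).
  by rewrite /= tN !inE negb_or !lt_eqF // (lt_trans ab).
by move=> y; rewrite !inE => /or4P[] /eqP ->.
Qed.

Section NatColouringToCondition.
Variables (R : realType) (k : nat) (chi : nat -> 'I_k) (S : {fset int}) (s0 : int).
Hypotheses (s0S : s0 \in S) (S3 : (3 <= #|` S|)%N).
Hypothesis APf : AP_free (fun n : nat => n%:R : R) chi.
Hypothesis AMf : AM_copy_free (fun n : nat => n%:R : R) chi S s0.

Lemma exists_other : exists2 s, s \in S & s != s0.
Proof.
apply: contrapT => H.
have : (#|` S| <= 1)%N; last by case: #|` S| S3 => [|[|]].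
apply: (@uniq_leq_size _ _ [:: s0]); first exact: fset_uniq.
move=> s sS; rewrite inE; apply: contrapT => /negP ss0.
by apply: H; exists s.
Qed.

(** If [s0] is extreme, a copy of scale [d] lies among [w + 1] consecutive terms of a progression of
    step [d], with the image of [s0] at one end. *)
Let w := (\max_(s <- S) `|(s0 - s)%R|)%N.

Let le_w s : s \in S -> (`|(s0 - s)%R| <= w)%N.
Proof. by move=> sS; exact: (leq_bigmax_seq (F := fun s => `|(s0 - s)%R|%N) s). Qed.

Lemma not_extreme_of_nat : ~ extreme_point S s0.
Proof.
have pos s : s != s0 -> (0 < `|(s0 - s)%R|)%N.
  by rewrite absz_gt0 subr_eq0 eq_sym.
have w0 : (0 < w)%N.
  have [s sS /pos ss0] := exists_other; exact: leq_trans ss0 (le_w sS).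
case=> _ [s0min|s0max]; apply: (AP_free_nat APf).
- apply: (monochromatic_AP_of_left_extension w0) => x d c d0 Hc.
  have := @AM_copy_free_nat R k chi S s0 s0S
    (fun s => x + `|(s0 - s)%R| * d)%N (x%:Z - d%:Z * s0) d c AMf d0.
  rewrite subrr mul0n addn0; apply; last 2 first.
  + exact: exists_other.
  + move=> s sS /pos; have := le_w sS.
    by case: (`|_|%N) => // j jw _; apply: Hc.
  + move=> s sS; rewrite PoszD PoszM -abszN opprB gez0_abs ?subr_ge0 ?s0min //; ring.
- apply: (@monochromatic_AP_of_right_extension _ w) => x d c d0 Hc.
  have := @AM_copy_free_nat R k chi S s0 s0S
    (fun s => x + (w - `|(s0 - s)%R|) * d)%N (x%:Z + d%:Z * (w%:Z - s0)) d c AMf d0.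
  rewrite subrr subn0; apply; last 2 first.
  + exact: exists_other.
  + by move=> s sS /pos sp; apply: Hc; rewrite ltn_subrL sp.
  + move=> s sS; rewrite PoszD PoszM -subzn ?le_w //.
    by rewrite gez0_abs ?subr_ge0 ?s0max //; ring.
Qed.

Lemma card_gt3_of_nat : (3 < #|` S|)%N.
Proof.
rewrite ltnNge; apply/negP => S3'.
have [l [r [lS rS ls0 s0r]]] := not_extreme_between s0S not_extreme_of_nat.
have [p' [q' [p'0 q'0 p'E q'E]]] : exists p' q' : nat,
    [/\ (0 < p')%N, (0 < q')%N, s0 = l + p'%:Z & r = s0 + q'%:Z].
  by exists `|s0 - l|%N, `|r - s0|%N; split; lia.
pose g := gcdn p' q'; have g0 : (0 < g)%N by rewrite gcdn_gt0 p'0.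
have [p pE] : exists p, p' = (g * p)%N.
  by exists (p' %/ g)%N; rewrite mulnC divnK // dvdn_gcdl.
have [q qE] : exists q, q' = (g * q)%N.
  by exists (q' %/ g)%N; rewrite mulnC divnK // dvdn_gcdr.
have p0 : (0 < p)%N by move: p'0; rewrite pE muln_gt0 => /andP[].
have q0 : (0 < q)%N by move: q'0; rewrite qE muln_gt0 => /andP[].
have pq : coprime p (p + q).
  rewrite /coprime gcdnDl -(eqn_pmul2l g0) muln1.
  by rewrite muln_gcdr -pE -qE.
(* Passing to the multiples of [g] divides both gaps by their gcd, which gives the coprimality used
   in [subdivide]. *)
have [|a [d [c [d0 Hc]]]] := @monochromatic_AP_of_ratio_closed _ p q
    (fun x => chi (g * x)%N) p0 q0 pq.
  move=> c x u H1 H2; have [->|u0] := posnP u; first by rewrite muln0 addn0.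
  have := @AM_copy_free_nat R k chi S s0 s0S
    (fun s => g * x + `|(s - l)%R| * u)%N ((g * x)%:Z - u%:Z * l) u c AMf u0.
  have -> : (`|(s0 - l)%R| = p')%N by lia.
  rewrite pE -mulnA -mulnDr; apply; last 2 first.
  - exact: exists_other.
  - move=> s /(only_three_points S3' ls0 s0r lS s0S rS).
    rewrite !inE => /or3P[] /eqP -> // sn.
    + by rewrite subrr mul0n addn0.
    + by rewrite eqxx in sn.
    + have -> : (`|(r - l)%R| = p' + q')%N by lia.
      by rewrite pE qE -mulnDr -mulnA -mulnDr.
  - move=> s sS; have : l <= s.
      have := only_three_points S3' ls0 s0r lS s0S rS sS.
      by rewrite !inE => /or3P[] /eqP ->; lia.
    by move=> ls; rewrite PoszD [(_ * u)%N%:Z]PoszM gez0_abs ?subr_ge0 //; ring.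
apply: (AP_free_nat APf).
exists (g * a)%N, (g * d)%N, c; rewrite muln_gt0 g0 d0; split=> // j.
by rewrite -(Hc j) mulnDr mulnCA.
Qed.

End NatColouringToCondition.

Theorem theorem2p1 (R : realType) (S : {fset int}) (s0 : int)
    (hS : (3 <= #|` S|)%N) (hs0 : s0 \in S) :
  [<->
    (* (i) *)
    exists (k : nat) (chi : nat -> 'I_k),
      AP_free (fun n : nat => n%:R : R) chi /\
      AM_copy_free (fun n : nat => n%:R : R) chi S s0;
    (* (ii) *)
    exists (k : nat) (chi : R -> 'I_k),
      AP_free (fun x : R => x) chi /\
      AM_copy_free (fun x : R => x) chi S s0;
    (* (iii) *)
    (3 < #|` S|)%N /\ ~ extreme_point S s0].
Proof.
have toN : (exists (k : nat) (chi : R -> 'I_k),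
      AP_free (fun x : R => x) chi /\
      AM_copy_free (fun x : R => x) chi S s0) ->
    exists (k : nat) (chi : nat -> 'I_k),
      AP_free (fun n : nat => n%:R : R) chi /\
      AM_copy_free (fun n : nat => n%:R : R) chi S s0.
  by move=> [k [chi [APf AMf]]]; exists k, (fun n => chi n%:R); exact: (restrict_to_nat APf AMf).
have toCond : (exists (k : nat) (chi : nat -> 'I_k),
      AP_free (fun n : nat => n%:R : R) chi /\
      AM_copy_free (fun n : nat => n%:R : R) chi S s0) ->
    (3 < #|` S|)%N /\ ~ extreme_point S s0.
  move=> [k [chi [APf AMf]]]; split; first exact: (card_gt3_of_nat hs0 hS APf AMf).
  exact: (not_extreme_of_nat hs0 hS APf AMf).
tfae.
- by move=> /toCond[S4 ext]; exact: colouring_of_reals.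
- by move=> /toN /toCond.
- by move=> [S4 ext]; apply: toN; exact: colouring_of_reals.
Qed.
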